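(* Every finite subdirectly irreducible $CMG_\sim$-algebra with a fixed point (an element $d$ with $d=\sim d$) is isomorphic to a functional monadic $G_\sim$-algebra.
   Context: A Gödel algebra is a Heyting algebra $\langle A,\vee,\wedge,\to,0,1\rangle$ satisfying $(x\to y)\vee(y\to x)\approx 1$; put $\neg x:=x\to 0$. A De Morgan algebra is a bounded distributive lattice with a unary operation $\sim$ satisfying $\sim\sim x\approx x$ and $\sim(x\wedge y)\approx \sim x\vee\sim y$. A $G_\sim$-algebra $\langle \mathbf A,\sim\rangle$ is a Gödel algebra $\mathbf A$ with a unary operation $\sim$ that makes its bounded lattice reduct a De Morgan algebra and satisfies $\neg x\le\sim x$. An $MG_\sim$-algebra is an algebra $\langle A,\vee,\wedge,\to,\sim,\exists,\forall,0,1\rangle$ such that $\langle \mathbf A,\sim\rangle$ is a $G_\sim$-algebra and: (M1) $\forall x\to x\approx 1$; (M2) $\forall(x\to\forall y)\approx\exists x\to\forall y$; (M3) $\forall(\forall x\to y)\approx\forall x\to\forall y$; (M4) $\forall(\exists x\vee y)\approx\exists x\vee\forall y$; (Q) $\forall x\approx\ \sim\exists\sim x$. A $CMG_\sim$-algebra is an $MG_\sim$-algebra satisfying (C): $\exists(x\wedge\sim x)\le\forall(x\vee\sim x)$. Functional monadic $G_\sim$-algebras: let $\langle\mathbf A,\sim\rangle$ be a totally ordered $G_\sim$-algebra and $X$ a nonempty set, and let $\langle \mathbf A^X,\sim\rangle$ be the power $G_\sim$-algebra with pointwise operations. Let $S$ be the set of $f\in A^X$ for which $\inf\{f(x):x\in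 X\}$ and $\sup\{f(x):x\in X\}$ both exist in $\mathbf A$. For $f\in S$ let $\forall_\wedge f$ and $\exists_\vee f$ be the constant functions with values $\inf\{f(y):y\in X\}$ and $\sup\{f(y):y\in X\}$, respectively. A functional monadic $G_\sim$-algebra is any algebra $\langle\mathbf B,\sim,\exists_\vee,\forall_\wedge\rangle$ where $\langle\mathbf B,\sim\rangle$ is a subalgebra of such an $\langle\mathbf A^X,\sim\rangle$ with $B\subseteq S$ and $B$ closed under $\exists_\vee$ and $\forall_\wedge$. *)

(* Defs.v *)
(* Algebras are treated as in universal
   algebra: a carrier with the operations of the signature, the varieties being
   predicates on such structures. *)
From mathcomp Require Import all_boot.
From mathcomp Require Import boolp classical_sets cardinality.

Set Implicit Arguments.
Unset Strict Implicit.
Unset Printing Implicit Defensive.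

Local Open Scope classical_set_scope.

(* Signature of G~-algebras. *)
Record gAlg := GAlg {
  gcar :> Type;
  join : gcar -> gcar -> gcar;
  meet : gcar -> gcar -> gcar;
  imp : gcar -> gcar -> gcar;
  sim : gcar -> gcar;
  zero : gcar;
  one : gcar }.

Arguments zero {g}.
Arguments one {g}.

Declare Scope galg_scope.
Delimit Scope galg_scope with G.
Local Open Scope galg_scope.

Notation "x ⊔ y" := (join x y) (at level 50, left associativity) : galg_scope.
Notation "x ⊓ y" := (meet x y) (at level 48, left associativity) : galg_scope.
Notation "x ⇒ y" := (imp x y) (at level 53, right associativity) : galg_scope.
Notation "∼ x" := (sim x) (at level 35, right associativity) : galg_scope.

Definition neg (A : gAlg) (x : A) : A := x ⇒ zero.
Notation "¬ x" := (neg x) (at level 35, right associativity) : galg_scope.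

Definition gle (A : gAlg) (x y : A) : Prop := x ⊓ y = x.
Notation "x ⊑ y" := (gle x y) (at level 70, no associativity) : galg_scope.

Record bounded_lattice (A : gAlg) : Prop := {
  joinC : forall x y : A, x ⊔ y = y ⊔ x;
  joinA : forall x y z : A, x ⊔ (y ⊔ z) = (x ⊔ y) ⊔ z;
  meetC : forall x y : A, x ⊓ y = y ⊓ x;
  meetA : forall x y z : A, x ⊓ (y ⊓ z) = (x ⊓ y) ⊓ z;
  joinKI : forall x y : A, x ⊔ (x ⊓ y) = x;
  meetKU : forall x y : A, x ⊓ (x ⊔ y) = x;
  zero_le : forall x : A, zero ⊑ x;
  le_one : forall x : A, x ⊑ one }.

Record heyting (A : gAlg) : Prop := {
  heyting_lattice : bounded_lattice A;
  residuation : forall x y z : A, (x ⊓ z ⊑ y) <-> (z ⊑ x ⇒ y) }.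

Record goedel (A : gAlg) : Prop := {
  goedel_heyting : heyting A;
  prelinearity : forall x y : A, (x ⇒ y) ⊔ (y ⇒ x) = one }.

Record de_morgan (A : gAlg) : Prop := {
  de_morgan_lattice : bounded_lattice A;
  meetUl : forall x y z : A, (x ⊔ y) ⊓ z = (x ⊓ z) ⊔ (y ⊓ z);
  simK : forall x : A, ∼ ∼ x = x;
  sim_meet : forall x y : A, ∼ (x ⊓ y) = ∼ x ⊔ ∼ y }.

Record Gsim (A : gAlg) : Prop := {
  Gsim_goedel : goedel A;
  Gsim_de_morgan : de_morgan A;
  neg_le_sim : forall x : A, ¬ x ⊑ ∼ x }.

Definition totally_ordered (A : gAlg) : Prop :=
  forall x y : A, x ⊑ y \/ y ⊑ x.

(* Signature of MG~-algebras. *)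
Record mgAlg := MGAlg {
  gred :> gAlg;
  mexists : gred -> gred;
  mforall : gred -> gred }.

Notation "'∃' x" := (mexists x) (at level 35, right associativity) : galg_scope.
Notation "'∀' x" := (mforall x) (at level 35, right associativity) : galg_scope.

Record MGsim (M : mgAlg) : Prop := {
  MGsim_Gsim : Gsim M;
  axM1 : forall x : M, (∀ x) ⇒ x = one;
  axM2 : forall x y : M, ∀ (x ⇒ ∀ y) = (∃ x) ⇒ (∀ y);
  axM3 : forall x y : M, ∀ ((∀ x) ⇒ y) = (∀ x) ⇒ (∀ y);
  axM4 : forall x y : M, ∀ ((∃ x) ⊔ y) = (∃ x) ⊔ (∀ y);
  axQ : forall x : M, ∀ x = ∼ ∃ ∼ x }.

Record CMGsim (M : mgAlg) : Prop := {
  CMGsim_MGsim : MGsim M;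
  axC : forall x : M, ∃ (x ⊓ ∼ x) ⊑ ∀ (x ⊔ ∼ x) }.

Record mg_hom (M N : mgAlg) (h : M -> N) : Prop := {
  hom_join : forall x y : M, h (x ⊔ y) = h x ⊔ h y;
  hom_meet : forall x y : M, h (x ⊓ y) = h x ⊓ h y;
  hom_imp : forall x y : M, h (x ⇒ y) = h x ⇒ h y;
  hom_sim : forall x : M, h (∼ x) = ∼ h x;
  hom_ex : forall x : M, h (∃ x) = ∃ h x;
  hom_all : forall x : M, h (∀ x) = ∀ h x;
  hom_zero : h zero = zero;
  hom_one : h one = one }.

Definition mg_iso (M N : mgAlg) (h : M -> N) : Prop := mg_hom h /\ bijective h.

Definition isomorphic (M N : mgAlg) : Prop := exists h : M -> N, mg_iso h.

Definition gprod (I : Type) (A : I -> gAlg) : gAlg :=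
  @GAlg (forall i, A i)
    (fun f g i => f i ⊔ g i)
    (fun f g i => f i ⊓ g i)
    (fun f g i => f i ⇒ g i)
    (fun f i => ∼ f i)
    (fun i => zero)
    (fun i => one).

Definition mgprod (I : Type) (A : I -> mgAlg) : mgAlg :=
  @MGAlg (gprod A) (fun f i => ∃ f i) (fun f i => ∀ f i).

Definition subdirect_embedding (M : mgAlg) (I : Type) (A : I -> mgAlg)
    (h : M -> mgprod A) : Prop :=
  [/\ mg_hom h, injective h
    & forall (i : I) (y : A i), exists x : M, h x i = y].

(* With nonempty index sets, as here, one-element algebras are subdirectly
   irreducible (Burris-Sankappanavar convention). *)
Definition subdirectly_irreducible (M : mgAlg) : Prop :=
  forall (I : Type) (A : I -> mgAlg) (h : M -> mgprod A),
    inhabited I -> subdirect_embedding h ->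
    exists i : I, mg_iso (fun x => h x i).

Record subuniverse (A : gAlg) (B : set A) : Prop := {
  sub_join : forall x y : A, B x -> B y -> B (x ⊔ y);
  sub_meet : forall x y : A, B x -> B y -> B (x ⊓ y);
  sub_imp : forall x y : A, B x -> B y -> B (x ⇒ y);
  sub_sim : forall x : A, B x -> B (∼ x);
  sub_zero : B zero;
  sub_one : B one }.

Definition subalg (A : gAlg) (B : set A) (sB : subuniverse B) : gAlg :=
  @GAlg {x : A | B x}
    (fun x y => exist _ _ (sub_join sB (proj2_sig x) (proj2_sig y)))
    (fun x y => exist _ _ (sub_meet sB (proj2_sig x) (proj2_sig y)))
    (fun x y => exist _ _ (sub_imp sB (proj2_sig x) (proj2_sig y)))
    (fun x => exist _ _ (sub_sim sB (proj2_sig x)))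
    (exist _ _ (sub_zero sB))
    (exist _ _ (sub_one sB)).

Definition gpower (A : gAlg) (X : Type) : gAlg := gprod (fun _ : X => A).

Section Bounds.
Variables (A : gAlg) (X : Type).
Implicit Types (f : gpower A X) (m : A).

Definition is_inf f m : Prop :=
  (forall y, m ⊑ f y) /\ (forall l : A, (forall y, l ⊑ f y) -> l ⊑ m).

Definition is_sup f m : Prop :=
  (forall y, f y ⊑ m) /\ (forall u : A, (forall y, f y ⊑ u) -> m ⊑ u).

Definition inf_sup_exist : set (gpower A X) :=
  [set f | (exists m, is_inf f m) /\ (exists m, is_sup f m)].

Definition constant_fun (m : A) : gpower A X := fun _ => m.

End Bounds.

(* The types of [exB] and [allB] express the closure of [B] under the two
   operators, and the last two hypotheses determine them uniquely. *)
Inductive functional_monadic : mgAlg -> Prop :=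
  FunctionalMonadic (A : gAlg) (X : Type)
    (B : set (gpower A X)) (sB : subuniverse B) (exB allB : subalg sB -> subalg sB) :
    Gsim A -> totally_ordered A -> inhabited X ->
    B `<=` @inf_sup_exist A X ->
    (forall f : subalg sB, exists m : A,
      is_sup (proj1_sig f) m /\ proj1_sig (exB f) = @constant_fun A X m) ->
    (forall f : subalg sB, exists m : A,
      is_inf (proj1_sig f) m /\ proj1_sig (allB f) = @constant_fun A X m) ->
    functional_monadic (@MGAlg (subalg sB) exB allB).

(* Main.v *)
(* A finite subdirectly irreducible algebra [M] is a product of finite chains,
   and its closed elements ([∃ x = x]) form a chain [K] that embeds in each
   factor; by (C) the fixed point [d] lies in [K].  A factor is mapped into a
   segment of the rationals, with [K] going to fixed integers, the involution to
   [-], and the elements in a gap of [K] to the corresponding open unit interval.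
   As [d] is in [K], the involution fixes no gap, so the elements of a gap can be
   moved as close as one likes to either of its ends.  In the function space over
   all these homomorphisms the supremum of the values of [x] is then the value of
   [∃ x], the least element of [K] above [x]. *)
From HB Require Import structures.
From mathcomp Require Import all_boot all_order all_algebra.
From mathcomp Require Import boolp classical_sets cardinality.
From mathcomp Require Import ring lra.
Require Import Defs.

Set Implicit Arguments.
Unset Strict Implicit.
Unset Printing Implicit Defensive.

Local Open Scope galg_scope.

(** * Order, involution and central elements in a [Gsim] algebra *)

Section GsimTheory.
Context (A : gAlg) (hA : Gsim A).
Implicit Types x y z w : A.

Let hH : heyting A := goedel_heyting (Gsim_goedel hA).
Let hL : bounded_lattice A := heyting_lattice hH.
Let hD : de_morgan A := Gsim_de_morgan hA.

Lemma glexx x : x ⊑ x.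
Proof. by rewrite /gle -{2}[x](joinKI hL x x) (meetKU hL). Qed.

Lemma gle_trans y x z : x ⊑ y -> y ⊑ z -> x ⊑ z.
Proof. by rewrite /gle => xy yz; rewrite -xy -(meetA hL) yz. Qed.

Lemma gle_anti x y : x ⊑ y -> y ⊑ x -> x = y.
Proof. by rewrite /gle => xy yx; rewrite -xy (meetC hL). Qed.

Lemma geIl x y : x ⊓ y ⊑ x.
Proof. by rewrite /gle (meetC hL) (meetA hL) [x ⊓ x]glexx. Qed.

Lemma geIr x y : x ⊓ y ⊑ y.
Proof. by rewrite (meetC hL); exact: geIl. Qed.

Lemma glexI x y z : z ⊑ x -> z ⊑ y -> z ⊑ x ⊓ y.
Proof. by rewrite /gle => zx zy; rewrite (meetA hL) zx. Qed.

Lemma gleUl x y : x ⊑ x ⊔ y.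
Proof. exact: (meetKU hL). Qed.

Lemma gleUr x y : y ⊑ x ⊔ y.
Proof. by rewrite (joinC hL); exact: gleUl. Qed.

Lemma gleE_join x y : x ⊑ y <-> x ⊔ y = y.
Proof.
split=> [xy|<-]; last exact: gleUl.
by rewrite -{1}xy (joinC hL) (meetC hL) (joinKI hL).
Qed.

Lemma gleUx x y z : x ⊑ z -> y ⊑ z -> x ⊔ y ⊑ z.
Proof.
by move=> /gleE_join xz /gleE_join yz; apply/gleE_join; rewrite -(joinA hL) yz.
Qed.

Lemma gle_imp x y z : x ⊓ z ⊑ y <-> z ⊑ x ⇒ y.
Proof. exact: (residuation hH). Qed.

Lemma gle_impI x y z : x ⊓ z ⊑ y -> z ⊑ x ⇒ y.
Proof. by move/gle_imp. Qed.

Lemma gle0x x : zero ⊑ x. Proof. exact: (zero_le hL). Qed.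
Lemma glex1 x : x ⊑ one. Proof. exact: (le_one hL). Qed.

Lemma gle1x x : one ⊑ x -> x = one.
Proof. by move=> h; apply: gle_anti => //; exact: glex1. Qed.

Lemma glex0 x : x ⊑ zero -> x = zero.
Proof. by move=> h; apply: gle_anti => //; exact: gle0x. Qed.

Lemma gmeetC x y : x ⊓ y = y ⊓ x. Proof. exact: (meetC hL). Qed.
Lemma gjoinC x y : x ⊔ y = y ⊔ x. Proof. exact: (joinC hL). Qed.

Lemma gmeet1 x : x ⊓ one = x. Proof. exact: glex1. Qed.

Lemma gjoin0 x : x ⊔ zero = x.
Proof. by rewrite gjoinC; apply/gleE_join/gle0x. Qed.

Lemma gmeetUl x y z : (x ⊔ y) ⊓ z = (x ⊓ z) ⊔ (y ⊓ z).
Proof. exact: (meetUl hD). Qed.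

Lemma gleI2 x y z w : x ⊑ z -> y ⊑ w -> x ⊓ y ⊑ z ⊓ w.
Proof.
by move=> xz yw; apply: glexI;
   [apply: gle_trans xz; exact: geIl|apply: gle_trans yw; exact: geIr].
Qed.

Lemma gleU2 x y z w : x ⊑ z -> y ⊑ w -> x ⊔ y ⊑ z ⊔ w.
Proof.
by move=> xz yw; apply: gleUx;
   [apply: gle_trans xz _; exact: gleUl|apply: gle_trans yw _; exact: gleUr].
Qed.

Lemma gle_imp1 x y : x ⇒ y = one <-> x ⊑ y.
Proof.
split=> [e|xy]; first by rewrite -[x]gmeet1; apply/gle_imp; rewrite e; exact: glexx.
by apply: gle1x; apply/gle_imp; rewrite gmeet1.
Qed.

Lemma gimpK x y : x ⊓ (x ⇒ y) ⊑ y.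
Proof. by apply/gle_imp; exact: glexx. Qed.

Lemma gsimK x : ∼ ∼ x = x. Proof. exact: (simK hD). Qed.

Lemma gsimI x y : ∼ (x ⊓ y) = ∼ x ⊔ ∼ y. Proof. exact: (sim_meet hD). Qed.

Lemma gsimU x y : ∼ (x ⊔ y) = ∼ x ⊓ ∼ y.
Proof. by rewrite -[RHS]gsimK gsimI !gsimK. Qed.

Lemma gle_sim x y : x ⊑ y -> ∼ y ⊑ ∼ x.
Proof. by move=> xy; rewrite -xy gsimI; exact: gleUr. Qed.

Lemma gsim0 : ∼ (zero : A) = one.
Proof.
by apply: gle1x; rewrite -[one]gsimK; apply: gle_sim; exact: gle0x.
Qed.

Lemma gsim1 : ∼ (one : A) = zero.
Proof. by rewrite -gsim0 gsimK. Qed.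

Definition central z := z ⊔ ∼ z = one.

Lemma centralI0 z : central z -> z ⊓ ∼ z = zero.
Proof.
by rewrite /central => cz; rewrite -[LHS]gsimK gsimI gsimK gjoinC cz gsim1.
Qed.

Lemma central_sim z : central z -> central (∼ z).
Proof. by rewrite /central gsimK gjoinC. Qed.

Lemma centralI z w : central z -> central w -> central (z ⊓ w).
Proof.
move=> cz cw; apply: gle1x; rewrite gsimI.
apply: (@gle_trans ((z ⊓ w) ⊔ (∼ z ⊓ w) ⊔ ∼ w)).
  by rewrite -gmeetUl cz gmeetC gmeet1 cw; exact: glexx.
apply: gleUx; last by apply: gle_trans (gleUr _ _); exact: gleUr.
apply: gleUx; first exact: gleUl.
by apply: gle_trans (geIl _ _) _; apply: gle_trans (gleUr _ _); exact: gleUl.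
Qed.

(* The largest central element below [x] (the Baaz projection). *)
Definition baaz x := ¬ ∼ x.

(** Prelinearity for [x] and [¬ x] yields the Stone identity [¬ x ⊔ ¬ ¬ x = one], and
    [¬ ¬ x ⊑ ∼ ¬ x]. *)
Lemma central_neg x : central (¬ x).
Proof.
have stone : ¬ x ⊔ ¬ ¬ x = one.
  have eqN : x ⇒ ¬ x = ¬ x.
    apply: gle_anti; apply/gle_imp; last first.
      by apply: gle_trans (gle0x _); exact: gimpK.
    apply: (@gle_trans (x ⊓ ¬ x)); last exact: gimpK.
    by apply: glexI; [exact: geIl|exact: gimpK].
  have leN : ¬ x ⇒ x ⊑ ¬ ¬ x.
    apply/gle_imp; apply: (@gle_trans (x ⊓ ¬ x)); last exact: gimpK.
    by apply: glexI; [exact: gimpK|exact: geIl].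
  apply: gle1x; rewrite -(prelinearity (Gsim_goedel hA) x (¬ x)) eqN.
  by apply: gleU2 leN; exact: glexx.
apply: gle1x; rewrite -{1}stone; apply: gleU2; first exact: glexx.
exact: (neg_le_sim hA).
Qed.

Lemma central_baaz x : central (baaz x).
Proof. exact: central_neg. Qed.

Lemma baaz_le x : baaz x ⊑ x.
Proof. by have := neg_le_sim hA (∼ x); rewrite gsimK. Qed.

Lemma central_le_baaz z x : central z -> z ⊑ x -> z ⊑ baaz x.
Proof.
move=> cz zx; apply/gle_imp; rewrite -(centralI0 cz) gmeetC.
by apply: gleI2; [exact: glexx|exact: gle_sim].
Qed.

(** As [y ⊑ ¬ x] and [¬ x] is central, [∼ ¬ x] is disjoint from [y], hence below [¬ y]. *)
Lemma gmeet_eq0_neg x y : x ⊓ y ⊑ zero -> ¬ x ⊔ ¬ y = one.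
Proof.
move=> xy; apply: gle1x; rewrite -(central_neg x).
apply: gleU2; first exact: glexx.
apply: gle_impI; rewrite -(centralI0 (central_neg x)).
by apply: gleI2; [exact: gle_impI|exact: glexx].
Qed.

(** By prelinearity [∼ (x ⇒ y)] and [∼ (y ⇒ x)] are disjoint. In this central form, prelinearity can
    be tested on direct factors. *)
Lemma baaz_prelinear x y : baaz (x ⇒ y) ⊔ baaz (y ⇒ x) = one.
Proof.
apply: gmeet_eq0_neg; rewrite -gsimU (prelinearity (Gsim_goedel hA)) gsim1.
exact: glexx.
Qed.

End GsimTheory.

Ltac le_meet hG :=
  first [ exact: (glexx hG) | apply: (glexI hG); le_meet hG
        | apply: (gle_trans hG (geIl hG _ _)); le_meet hG
        | apply: (gle_trans hG (geIr hG _ _)); le_meet hG ].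

(** * Quantifiers, closed elements and subdirect irreducibility *)

Section MonadicTheory.
Context (M : mgAlg) (hM : MGsim M).
Implicit Types x y z : M.

Let hG : Gsim M := MGsim_Gsim hM.

Lemma mforall_le x : ∀ x ⊑ x.
Proof. by apply/(gle_imp1 hG); exact: (axM1 hM). Qed.

Lemma sim_mexists x : ∼ ∃ x = ∀ ∼ x.
Proof. by rewrite (axQ hM) (gsimK hG). Qed.

Lemma sim_mforall x : ∼ ∀ x = ∃ ∼ x.
Proof. by rewrite (axQ hM) (gsimK hG). Qed.

Lemma le_mexists x : x ⊑ ∃ x.
Proof.
rewrite -[x in X in X ⊑ _](gsimK hG) -[X in _ ⊑ X](gsimK hG) sim_mexists.
by apply: (gle_sim hG); exact: mforall_le.
Qed.

Lemma mforall1 : ∀ (one : M) = one.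
Proof.
rewrite -[X in ∀ X](axM1 hM one) (axM3 hM).
by apply/(gle_imp1 hG); exact: (glexx hG).
Qed.

Lemma mforall_mono x y : x ⊑ y -> ∀ x ⊑ ∀ y.
Proof.
move=> xy; apply/(gle_imp1 hG); rewrite -(axM3 hM).
have /(gle_imp1 hG) -> : ∀ x ⊑ y by apply: (gle_trans hG) xy; exact: mforall_le.
exact: mforall1.
Qed.

Lemma mexists_mono x y : x ⊑ y -> ∃ x ⊑ ∃ y.
Proof.
move=> xy; rewrite -[∃ x](gsimK hG) -[∃ y](gsimK hG) !sim_mexists.
by apply: (gle_sim hG); apply: mforall_mono; exact: (gle_sim hG).
Qed.

(** This is (M4) with [y] taken to be [zero]. *)
Lemma mforall_mexists x : ∀ ∃ x = ∃ x.
Proof.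
have := axM4 hM x zero; rewrite !(gjoin0 hG) => ->.
by rewrite (glex0 hG (mforall_le _)) (gjoin0 hG).
Qed.

Lemma mexists_mforall x : ∃ ∀ x = ∀ x.
Proof.
by rewrite -[LHS](gsimK hG) sim_mexists (sim_mforall x) mforall_mexists
           -sim_mforall (gsimK hG).
Qed.

Lemma mexistsK x : ∃ ∃ x = ∃ x.
Proof. by rewrite -[∃ x]mforall_mexists mexists_mforall. Qed.

Definition closed x := ∃ x = x.

Lemma closed_mforall x : closed x <-> ∀ x = x.
Proof.
by split=> [<-|<-]; [exact: mforall_mexists|exact: mexists_mforall].
Qed.

Lemma closed_mexists x : closed (∃ x). Proof. exact: mexistsK. Qed.

Lemma closed_sim x : closed x -> closed (∼ x).
Proof. by move=> cx; apply/closed_mforall; rewrite -sim_mexists cx. Qed.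

Lemma closed0 : closed zero.
Proof. by apply/closed_mforall; apply: (glex0 hG); exact: mforall_le. Qed.

Lemma closed1 : closed one.
Proof. by apply/closed_mforall; exact: mforall1. Qed.

Lemma closed_imp x y : closed x -> closed y -> closed (x ⇒ y).
Proof.
move=> /closed_mforall cx /closed_mforall cy; apply/closed_mforall.
by rewrite -{1}cx (axM3 hM) cx cy.
Qed.

Lemma closed_baaz x : closed x -> closed (baaz x).
Proof. by move=> cx; apply: closed_imp closed0; exact: closed_sim. Qed.

Lemma mexists_le x z : closed z -> x ⊑ z -> ∃ x ⊑ z.
Proof. by move=> cz /mexists_mono; rewrite cz. Qed.

Lemma le_mforall x z : closed z -> z ⊑ x -> z ⊑ ∀ x.
Proof. by move=> /closed_mforall cz /mforall_mono; rewrite cz. Qed.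

(** The dual of (M4) under [∼]. *)
Lemma mexistsI x z : closed z -> ∃ (x ⊓ z) = ∃ x ⊓ z.
Proof.
move=> /closed_sim cz; rewrite -[LHS](gsimK hG) sim_mexists (gsimI hG).
by rewrite (gjoinC hG) -cz (axM4 hM) cz (gjoinC hG) -sim_mexists -(gsimI hG)
           (gsimK hG).
Qed.

(** From right to left: [∀ x ⊓ z] is closed and below [x ⊓ z], hence below [∀ (x ⊓ z)]. *)
Lemma mforallI x z : closed z -> ∀ (x ⊓ z) ⊓ z = ∀ x ⊓ z.
Proof.
move=> cz; apply: (gle_anti hG).
  by apply: (gleI2 hG); [apply: mforall_mono; exact: (geIl hG)|exact: (glexx hG)].
have cI : closed (∀ x ⊓ z) by rewrite /closed mexistsI // mexists_mforall.
apply: (glexI hG); last exact: (geIr hG).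
by apply: (le_mforall cI); apply: (gleI2 hG); [exact: mforall_le|exact: (glexx hG)].
Qed.

(* The quotient by the congruence of a closed central [z], realized on the
   elements below [z]. *)
Definition below z := {x : M | x ⊑ z}.

Definition relativize z (x : M) : below z := exist _ (x ⊓ z) (geIr hG x z).

Definition below_alg z : mgAlg :=
  @MGAlg (@GAlg (below z)
    (fun u v => relativize z (sval u ⊔ sval v))
    (fun u v => relativize z (sval u ⊓ sval v))
    (fun u v => relativize z (sval u ⇒ sval v))
    (fun u => relativize z (∼ sval u))
    (relativize z zero)
    (relativize z one))
  (fun u => relativize z (∃ sval u))
  (fun u => relativize z (∀ sval u)).

Lemma relativize_eq z x y : x ⊓ z = y ⊓ z -> relativize z x = relativize z y.
Proof. by move=> e; apply: eq_exist. Qed.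

(** Centrality serves [∼], where the part [∼ z ⊓ z] vanishes; closedness serves the quantifiers. *)
Lemma relativize_hom z : closed z -> central z ->
  @mg_hom M (below_alg z) (relativize z).
Proof.
move=> kz cz.
have meetK w : w ⊓ z ⊓ z = w ⊓ z by exact: (geIr hG).
split=> [x y|x y|x y|x|x|x||] //=; apply: relativize_eq => /=.
- by rewrite !(gmeetUl hG) !meetK.
- by apply: (gle_anti hG); le_meet hG.
- apply: (gle_anti hG); apply: (glexI hG); do ?exact: (geIr hG).
    apply: (gle_impI hG); apply: (glexI hG); last by le_meet hG.
    by apply: (gle_trans hG) (gimpK hG x y); le_meet hG.
  apply: (gle_impI hG); apply: (gle_trans hG) (geIl hG y z).
  by apply: (gle_trans hG) (gimpK hG (x ⊓ z) (y ⊓ z)); le_meet hG.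
- by rewrite (gsimI hG) (gmeetUl hG) [∼ z ⊓ z](gmeetC hG) (centralI0 hG cz)
             (gjoin0 hG).
- by rewrite mexistsI // meetK.
- by rewrite mforallI.
Qed.

(** The relativizations to [z] and [∼ z] together form a subdirect embedding, so one of them is
    injective; it sends both [w b] and [one] to its top. *)
Lemma si_central_closed z : subdirectly_irreducible M ->
  closed z -> central z -> z = zero \/ z = one.
Proof.
move=> si kz cz.
pose w (b : bool) := if b then z else ∼ z.
have kw b : closed (w b) by case: b => //; exact: closed_sim.
have cw b : central (w b) by case: b => //; exact: (central_sim hG).
pose h (x : M) : mgprod (fun b => below_alg (w b)) := fun b => relativize (w b) x.
have emb : subdirect_embedding h.
  split.
  - split=> [x y|x y|x y|x|x|x||]; apply: functional_extensionality_dep => b.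
    + exact: (hom_join (relativize_hom (kw b) (cw b))).
    + exact: (hom_meet (relativize_hom (kw b) (cw b))).
    + exact: (hom_imp (relativize_hom (kw b) (cw b))).
    + exact: (hom_sim (relativize_hom (kw b) (cw b))).
    + exact: (hom_ex (relativize_hom (kw b) (cw b))).
    + exact: (hom_all (relativize_hom (kw b) (cw b))).
    + exact: (hom_zero (relativize_hom (kw b) (cw b))).
    + exact: (hom_one (relativize_hom (kw b) (cw b))).
  - move=> x y hxy.
    have E b : x ⊓ w b = y ⊓ w b by have := congr1 (fun f => sval (f b)) hxy.
    have split v : v = (v ⊓ z) ⊔ (v ⊓ ∼ z).
      by rewrite -{1}[v](gmeet1 hG) -cz (gmeetC hG) (gmeetUl hG)
                 ![_ ⊓ v](gmeetC hG).
    by rewrite [x]split [y]split (E true) (E false).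
  - move=> b [y yb]; exists y; apply: eq_exist.
    exact: yb.
have [b [_ /bij_inj inj]] := si bool _ h (inhabits true) emb.
have wb1 : w b = one.
  apply: inj; apply: eq_exist => /=.
  by rewrite (glexx hG) (gmeetC hG) (gmeet1 hG).
case: b wb1 {inj} => /= [->|wb1]; first by right.
by left; rewrite -[z](gsimK hG) wb1 (gsim1 hG).
Qed.

(** The Baaz projections of [c ⇒ c'] and [c' ⇒ c] are closed and central, so each is [zero] or
    [one], and they join to [one]. *)
Lemma si_closed_total c c' : subdirectly_irreducible M ->
  closed c -> closed c' -> c ⊑ c' \/ c' ⊑ c.
Proof.
move=> si kc kc'.
have D x y : closed x -> closed y -> baaz (x ⇒ y) = zero \/ x ⊑ y.
  move=> kx ky.
  have [->|e] := si_central_closed si (closed_baaz (closed_imp kx ky))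
    (central_baaz hG _).
  - by left.
  - by right; apply/(gle_imp1 hG)/(gle1x hG); rewrite -e; exact: (baaz_le hG).
have [e1|] := D _ _ kc kc'; last by left.
have [e2|] := D _ _ kc' kc; last by right.
(* If both projections vanish, then [zero = one] and every inequality holds. *)
left; have := baaz_prelinear hG c c'; rewrite e1 e2 (gjoin0 hG) => e.
by apply: (gle_trans hG (glex1 hG c)); rewrite -e; exact: (gle0x hG).
Qed.

End MonadicTheory.

(** For a fixed point, (C) reads [∃ d ⊑ ∀ d]. *)
Lemma closed_fixpoint (M : mgAlg) (hM : CMGsim M) (d : M) : d = ∼ d -> closed d.
Proof.
move=> dd; have h := CMGsim_MGsim hM; have hG := MGsim_Gsim h.
have := axC hM d; rewrite -dd.
have -> : d ⊓ d = d by exact: (glexx hG).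
have -> : d ⊔ d = d by apply/(gleE_join hG); exact: (glexx hG).
move=> le; apply: (gle_anti hG); last exact: (le_mexists h).
by apply: (gle_trans hG) le _; exact: (mforall_le h).
Qed.

(** * Cardinality of subsets of a finite type, axiomatized on predicates *)

Definition counting (T : Type) (N : (T -> Prop) -> nat) : Prop :=
  [/\ N (fun=> False) = 0%N,
   forall P Q : T -> Prop, (forall y, P y -> Q y) -> N P <= N Q
   & forall (P Q : T -> Prop) x, ~ P x -> (forall y, Q y <-> P y \/ y = x) ->
     N Q = (N P).+1].

(** Predicates are counted along a repetition-free enumeration, with classical decidable equality.
    All later uses of finiteness go through the three rules of [counting]. *)
Lemma finite_counting (T : Type) :
  finite_set [set: T]%classic -> exists N : (T -> Prop) -> nat, counting N.
Proof.
move=> /(@finite_seqP {classic T}) [s0 s0T].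
pose s := undup s0.
have us : uniq s by exact: undup_uniq.
have sT (x : {classic T}) : x \in s.
  by rewrite mem_undup; have : [set` s0]%classic x by rewrite -s0T.
exists (fun P => count (fun z : {classic T} => `[< P z >]) s).
split=> [|P Q PQ|P Q x nPx QP].
- by rewrite -[RHS](count_pred0 s); apply: eq_count => y; apply/asboolP.
  by apply: sub_count => y /asboolP /PQ Qy; apply/asboolP.
(* The added 1 is the multiplicity of [x] in [s]; the intersection term of inclusion-exclusion
   vanishes because [P x] fails. *)
rewrite -[RHS]addn1 -[in RHS](_ : count_mem (x : {classic T}) s = 1%N).
  rewrite -count_predUI [X in (_ + X)%N](_ : _ = 0%N) ?addn0.
    apply: eq_count => y /=; apply/asboolP/orP => [/QP [Py|->]|[/asboolP Py|/eqP ->]].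
    - by left; apply/asboolP.
    - by right.
    - by apply/QP; left.
    - by apply/QP; right.
  rewrite -(count_pred0 s); apply: eq_count => y /=.
  by apply/negP => /andP [/asboolP Py /eqP e]; apply: nPx; rewrite -e.
by rewrite count_uniq_mem // sT.
Qed.

Lemma counting_lt (T : Type) (N : (T -> Prop) -> nat) (P Q : T -> Prop) x :
  counting N -> (forall y, P y -> Q y) -> ~ P x -> Q x -> N P < N Q.
Proof.
move=> [_ mono add1] PQ nPx Qx.
rewrite -(add1 P (fun y => P y \/ y = x) x) //.
by apply: mono => y [/PQ //|->].
Qed.

(** * Atoms of the centre separate the elements *)

Section Atoms.
Context (A : gAlg) (hA : Gsim A) (N : (A -> Prop) -> nat) (hN : counting N).
Implicit Types x y z e : A.

(** Descent on the number of elements below [z]: passing to a smaller [y] loses at least [z]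
    itself. *)
Lemma exists_minimal (P : A -> Prop) z : P z ->
  exists2 m, m ⊑ z & P m /\ forall y, P y -> y ⊑ m -> y = m.
Proof.
have [n] := ubnP (N (fun y => y ⊑ z)); elim: n z => // n IH z lt Pz.
have [[y [Py yz nyz]]|nex] := pselect (exists y, [/\ P y, y ⊑ z & y <> z]).
  have [|//|m my mP] := IH y.
    rewrite -ltnS; apply: leq_trans lt; rewrite ltnS.
    apply: (counting_lt (x := z) hN).
    - by move=> w wy; exact: (gle_trans hA wy yz).
    - by move=> zy; apply: nyz; exact: (gle_anti hA).
    - exact: (glexx hA).
  by exists m => //; exact: (gle_trans hA my yz).
exists z; first exact: (glexx hA).
split=> // y Py yz; apply: contrapT => nyz; apply: nex.
by exists y.
Qed.

(* In a finite algebra the prime elements are the atoms of the centre, so that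
   [x |-> x ⊓ e] is the projection onto a totally ordered direct factor. *)
Definition prime_central e :=
  [/\ e <> zero, central e & forall x y, e ⊑ x ⇒ y \/ e ⊑ y ⇒ x].

(** A minimal nonzero central [e] is below [baaz w] or disjoint from it, for every [w]. By
    [baaz_prelinear] it cannot be disjoint from the projections of both implications. *)
Lemma exists_prime_central z : central z -> z <> zero ->
  exists2 e, prime_central e & e ⊑ z.
Proof.
move=> cz nz.
have [e ez [[ce ne] emin]] :=
  @exists_minimal (fun e => central e /\ e <> zero) z (conj cz nz).
exists e => //; split=> // x y.
have D w : e ⊑ baaz w \/ e ⊓ baaz w = zero.
  have [e0|n0] := pselect (e ⊓ baaz w = zero); [by right|left].
  rewrite -(emin (e ⊓ baaz w)); [exact: (geIr hA)| |exact: (geIl hA)].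
  by split=> //; apply: (centralI hA) => //; exact: (central_baaz hA).
have [le|x0] := D (x ⇒ y).
  by left; apply: (gle_trans hA le); exact: (baaz_le hA).
have [le|y0] := D (y ⇒ x).
  by right; apply: (gle_trans hA le); exact: (baaz_le hA).
case: ne; rewrite -[e](gmeet1 hA) -(baaz_prelinear hA x y) (gmeetC hA).
rewrite (gmeetUl hA) ![_ ⊓ e](gmeetC hA) x0 y0.
exact: (gjoin0 hA).
Qed.

(** An atom [e] below the complement of [baaz (x ⇒ y)] works: [x ⊓ e ⊑ y] would put the central [e]
    below [baaz (x ⇒ y)] too. *)
Lemma prime_central_separates x y : ~ x ⊑ y ->
  exists2 e, prime_central e & ~ x ⊓ e ⊑ y.
Proof.
move=> nxy; pose c := baaz (x ⇒ y).
have cc : central (∼ c) by apply: (central_sim hA); exact: (central_baaz hA).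
have [|e pe ec] := exists_prime_central cc.
  move=> c0; apply: nxy; apply/(gle_imp1 hA)/(gle1x hA).
  by rewrite -(gsim0 hA) -c0 (gsimK hA); exact: (baaz_le hA).
exists e => // xey; case: pe => ne ce _; apply: ne; apply: (glex0 hA).
rewrite -(centralI0 hA (central_baaz hA (x ⇒ y))).
apply: (glexI hA) => //; apply: (central_le_baaz hA ce).
exact: (gle_impI hA).
Qed.

End Atoms.

(** * Functional algebras from separating families of homomorphisms *)

Record gsim_hom (A B : gAlg) (h : A -> B) : Prop := {
  ghom_join : forall x y : A, h (x ⊔ y) = h x ⊔ h y;
  ghom_meet : forall x y : A, h (x ⊓ y) = h x ⊓ h y;
  ghom_imp : forall x y : A, h (x ⇒ y) = h x ⇒ h y;
  ghom_sim : forall x : A, h (∼ x) = ∼ h x;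
  ghom_zero : h zero = zero;
  ghom_one : h one = one }.

Section FunctionalFamily.
Context (M : mgAlg) (hM : MGsim M) (A : gAlg) (hA : Gsim A) (X : Type).
Context (phi : X -> M -> A) (hphi : forall i, gsim_hom (phi i)).

Let h (x : M) : gpower A X := fun i => phi i x.

Lemma is_inf_sim (f g : gpower A X) m : (forall i, f i = ∼ g i) ->
  is_sup g m -> is_inf f (∼ m).
Proof.
move=> fg [ub lub]; split=> [i|l hl].
  by rewrite fg; apply: (gle_sim hA); exact: ub.
rewrite -[l](gsimK hA); apply: (gle_sim hA); apply: lub => i.
by rewrite -[g i](gsimK hA) -fg; apply: (gle_sim hA); exact: hl.
Qed.

(** The family embeds [M] in the power, and the quantifiers are transported to the image. Suprema
    suffice as data, since (Q) and [∼] turn them into infima. *)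
Lemma functional_of_family : totally_ordered A -> inhabited X ->
  (forall x y, (forall i, phi i x = phi i y) -> x = y) ->
  (forall x, exists m, is_sup (h x) m /\ forall i, phi i (∃ x) = m) ->
  exists N : mgAlg, functional_monadic N /\ isomorphic M N.
Proof.
move=> tA hX phi_inj phi_sup.
have phi_inf x : exists m, is_inf (h x) m /\ forall i, phi i (∀ x) = m.
  have [m [supm em]] := phi_sup (∼ x); exists (∼ m); split.
    apply: is_inf_sim supm => i.
    by rewrite /h (ghom_sim (hphi i)) (gsimK hA).
  by move=> i; rewrite (axQ hM) (ghom_sim (hphi i)) em.
pose B : set (gpower A X) := fun f => exists x, h x = f.
have h_ext (x : M) (f : gpower A X) : (forall i, phi i x = f i) -> h x = f.
  by move=> e; apply: functional_extensionality_dep.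
have sB : subuniverse B.
  split.
  - by move=> _ _ [x <-] [y <-]; exists (x ⊔ y); apply: h_ext => i;
       rewrite (ghom_join (hphi i)).
  - by move=> _ _ [x <-] [y <-]; exists (x ⊓ y); apply: h_ext => i;
       rewrite (ghom_meet (hphi i)).
  - by move=> _ _ [x <-] [y <-]; exists (x ⇒ y); apply: h_ext => i;
       rewrite (ghom_imp (hphi i)).
  - by move=> _ [x <-]; exists (∼ x); apply: h_ext => i;
       rewrite (ghom_sim (hphi i)).
  - by exists zero; apply: h_ext => i; rewrite (ghom_zero (hphi i)).
  - by exists one; apply: h_ext => i; rewrite (ghom_one (hphi i)).
pose k (x : M) : subalg sB := exist _ (h x) (ex_intro _ x erefl).
(* [B] only asserts that a preimage exists; choice picks one, unique by [phi_inj]. *)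
pose g (f : subalg sB) : M := projT1 (cid (proj2_sig f)).
have hg (f : subalg sB) : h (g f) = sval f by exact: (projT2 (cid (proj2_sig f))).
have gk x : g (k x) = x.
  by apply: phi_inj => i; have := congr1 (fun f => f i) (hg (k x)).
have kg f : k (g f) = f.
  by apply: eq_sig_hprop => [? ? ?|]; [exact: Prop_irrelevance|exact: hg].
have kE (x : M) (f : subalg sB) : (forall i, phi i x = sval f i) -> k x = f.
  move=> e; apply: eq_sig_hprop => [? ? ?|]; last exact: h_ext.
  exact: Prop_irrelevance.
exists (@MGAlg (subalg sB) (fun f => k (∃ g f)) (fun f => k (∀ g f))); split.
  apply: (@FunctionalMonadic A X B sB) => //.
  - move=> _ [x <-]; split.
      by have [m [? _]] := phi_inf x; exists m.
    by have [m [? _]] := phi_sup x; exists m.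
  - move=> f; have [m [supm em]] := phi_sup (g f); exists m.
    by rewrite -hg; split=> //; exact: h_ext.
  - move=> f; have [m [supm em]] := phi_inf (g f); exists m.
    by rewrite -hg; split=> //; exact: h_ext.
exists k; split; last by exists g.
split=> [x y|x y|x y|x|x|x||]; do ?[by rewrite /= gk]; apply: kE => i /=.
- exact: (ghom_join (hphi i)).
- exact: (ghom_meet (hphi i)).
- exact: (ghom_imp (hphi i)).
- exact: (ghom_sim (hphi i)).
- exact: (ghom_zero (hphi i)).
- exact: (ghom_one (hphi i)).
Qed.

End FunctionalFamily.

(** Treated apart because a one-element algebra has no prime central element. It is itself a chain,
    and one point suffices. *)
Lemma functional_trivial (M : mgAlg) : MGsim M -> (zero : M) = one ->
  exists N : mgAlg, functional_monadic N /\ isomorphic M N.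
Proof.
move=> hM e01; have hG := MGsim_Gsim hM.
have all_eq (x y : M) : x = y.
  by apply: (gle_anti hG); apply: (gle_trans hG (glex1 hG _));
     rewrite -e01; exact: (gle0x hG).
apply: (@functional_of_family M hM M hG unit (fun _ x => x)) => //.
- by move=> x y; left; exact: all_eq.
- by move=> x; exists x; split; [split=> [_|u _]|move=> _]; exact: all_eq.
Qed.

(** * Bounded chains with an antitone involution as [Gsim] algebras *)

Section ChainAlgebra.
Import Order.TTheory.
Local Open Scope order_scope.
Context (disp : Order.disp_t) (T : orderType disp) (b t : T) (s : T -> T).

Definition chain_alg : gAlg :=
  @GAlg T Order.max Order.min (fun x y => if x <= y then t else y) s b t.

Context (b_le : forall x : T, b <= x).
Context (le_t : forall x : T, x <= t).
Context (s_anti : forall x y : T, x <= y -> s y <= s x).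
Context (sK : involutive s).

Lemma chain_gle (x y : chain_alg) : x ⊑ y <-> x <= y :> T.
Proof. by rewrite /gle /=; split=> [/min_idPl|/min_idPl]. Qed.

Lemma chain_total : totally_ordered chain_alg.
Proof.
by move=> x y; case/orP: (le_total (x : T) y) => h; [left|right]; apply/chain_gle.
Qed.

Lemma chain_Gsim : Gsim chain_alg.
Proof.
have sb : s b = t.
  by apply: le_anti; rewrite le_t -[t]sK s_anti.
have hL : bounded_lattice chain_alg.
  split=> [x y|x y z|x y|x y z|x y|x y|x|x] /=.
  - exact: maxC.
  - exact: maxA.
  - exact: minC.
  - exact: minA.
  - exact: minKx.
  - exact: maxKx.
  - exact/chain_gle/b_le.
  - exact/chain_gle/le_t.
split; first split; first split => //.
- move=> x y z; split=> /chain_gle /= h; apply/chain_gle => /=.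
    case: ifP h => // /negbT; rewrite -ltNge => yx.
    rewrite ge_min => /orP [xy|//].
    by rewrite leNgt yx in xy.
  by case: ifP h => [xy _|_ zy]; rewrite ge_min ?xy // zy orbT.
- move=> x y /=; case/orP: (le_total (x : T) y) => ->.
    by apply/max_idPl; exact: le_t.
  by apply/max_idPr; exact: le_t.
- split=> // [x y z|x y] /=; first exact: min_maxl.
  by case/orP: (le_total (x : T) y) => h; have := s_anti h;
     [rewrite (min_idPl h) => /max_idPl ->|rewrite (min_idPr h) => /max_idPr ->].
(* In a chain [¬ x] is the bottom unless [x] is; in that case [∼ x] is the top. *)
- move=> x; apply/chain_gle; rewrite /neg /=; case: ifP => // xb.
  by rewrite (_ : x = b) ?sb //; apply: le_anti; rewrite xb b_le.
Qed.

(** As [e] is prime, [x ⊓ e ⊑ y] is a total preorder in [x] and [y]. Representing it by [phi]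
    suffices, because the order of a chain and its top determine meet, join and implication. *)
Lemma chain_hom (A : gAlg) (hA : Gsim A) (e : A) (phi : A -> T) :
  prime_central e ->
  (forall x y, x ⊓ e ⊑ y <-> phi x <= phi y) ->
  (forall x, phi (∼ x) = s (phi x)) -> phi one = t ->
  @gsim_hom A chain_alg phi.
Proof.
move=> [_ _ pe] leE phiS phi1.
have mono x y : x ⊑ y -> phi x <= phi y.
  by move=> xy; apply/leE; apply: (gle_trans hA) xy; exact: (geIl hA).
have tot x y : x ⊓ e ⊑ y \/ y ⊓ e ⊑ x.
  by have [h|h] := pe x y; [left|right]; apply/(gle_imp hA).
have phiI x y : phi (x ⊓ y) = Order.min (phi x) (phi y).
  wlog : x y / x ⊓ e ⊑ y => [W|xy].
    by have [|h] := tot x y; [exact: W|rewrite (gmeetC hA) minC; exact: W].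
  have /min_idPl -> : phi x <= phi y by apply/leE.
  apply: le_anti; rewrite mono; last exact: (geIl hA).
  by apply/leE; apply: (glexI hA) => //; exact: (geIl hA).
have phiU x y : phi (x ⊔ y) = Order.max (phi x) (phi y).
  wlog : x y / x ⊓ e ⊑ y => [W|xy].
    by have [|h] := tot x y; [exact: W|rewrite (gjoinC hA) maxC; exact: W].
  have /max_idPr -> : phi x <= phi y by apply/leE.
  apply: le_anti; rewrite (mono y); last exact: (gleUr hA).
  rewrite andbT; apply/leE; rewrite (gmeetUl hA).
  by apply: (gleUx hA) => //; exact: (geIl hA).
split=> // [x y|] /=; last first.
  rewrite -(gsim1 hA) phiS phi1; apply: le_anti; rewrite b_le andbT.
  by rewrite -[leRHS]sK s_anti.
case: ifP => [/leE xy|/negbT nxy].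
  rewrite -phi1; apply: le_anti; rewrite mono; last exact: (glex1 hA).
  by apply/leE; rewrite (gmeetC hA) (gmeet1 hA); exact: (gle_impI hA).
have {}nxy : ~ x ⊓ e ⊑ y by move/leE; exact/negP.
apply: le_anti; apply/andP; split; last first.
  by apply: mono; apply: (gle_impI hA); exact: (geIr hA).
(* Modus ponens in both cases: it puts [x ⇒ y] below [y] in the first, and [x] below [y], against
   [nxy], in the second. *)
apply/leE; have [ix|xi] := tot (x ⇒ y) x.
  apply: (gle_trans hA) (gimpK hA x y); apply: (glexI hA) => //.
  exact: (geIl hA).
case: nxy; apply: (gle_trans hA) (gimpK hA x y); apply: (glexI hA) => //.
exact: (geIl hA).
Qed.

End ChainAlgebra.

Import Order.TTheory GRing.Theory Num.Theory.

Local Open Scope ring_scope.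

(** * An increasing map of the half-line into the unit interval *)

Section Saturation.
Variable R : realFieldType.
(** Equals [a / (1 + a)] for nonnegative [a]. *)
Definition saturate (a : R) : R := 1 - (1 + a)^-1.
Lemma saturate_le (a b : R) : 0 <= a -> (a <= b) -> (saturate a <= saturate b).
Proof.
move=> a0 ab; rewrite /saturate lerD2l lerN2 lef_pV2 ?posrE ?lerD2l //; lra.
Qed.
Lemma saturate_lt (a b : R) : 0 <= a -> (a < b) -> (saturate a < saturate b).
Proof.
move=> a0 ab; rewrite /saturate ltrD2l ltrN2 ltf_pV2 ?posrE ?ltrD2l //; lra.
Qed.
Lemma saturate0 : saturate 0 = 0.
Proof. by rewrite /saturate addr0 invr1 subrr. Qed.
Lemma saturate_ge0 (a : R) : 0 <= a -> 0 <= saturate a.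
Proof. by move=> a0; rewrite -saturate0 saturate_le. Qed.
Lemma saturate_lt1 (a : R) : 0 <= a -> saturate a < 1.
Proof. by move=> a0; rewrite /saturate ltrBlDr ltrDl invr_gt0; lra. Qed.

(** As [q] grows, [saturate (t * q)] comes arbitrarily close to 1. *)
Lemma saturate_sup (s t u : R) : 0 < t ->
  (forall q, 0 < q -> s + saturate (t * q) <= u) -> s + 1 <= u.
Proof.
move=> t0 ub; rewrite leNgt; apply/negP => us.
pose eps := s + 1 - u; have eps0 : 0 < eps by rewrite /eps; lra.
(* At this [q] the distance from [saturate (t * q)] to 1 is [eps / (eps + 1)], less than [eps]. *)
have q0 : 0 < (t * eps)^-1 by rewrite invr_gt0 mulr_gt0.
have := ub _ q0; rewrite /saturate.
have -> : (1 + t * (t * eps)^-1)^-1 = eps / (eps + 1).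
  by field; rewrite !lt0r_neq0 //; lra.
have : eps / (eps + 1) < eps by rewrite ltr_pdivrMr; nra.
rewrite /eps; lra.
Qed.

(** As [q] goes to 0, so does [saturate (t * q)]. The signs fit the gaps below [d], whose
    coordinates are negated. *)
Lemma saturate_inf (s t u : R) : 0 <= t ->
  (forall q, 0 < q -> - (s + saturate (t * q)) <= u) -> - s <= u.
Proof.
move=> t0 ub; rewrite leNgt; apply/negP => us.
pose eps := - s - u; have eps0 : 0 < eps by rewrite /eps; lra.
(* Dividing by [t + 1] rather than [t] allows [t = 0] and still gives [t * q <= eps]. *)
have q0 : 0 < eps / (t + 1) by rewrite divr_gt0 //; lra.
have := ub _ q0.
have : saturate (t * (eps / (t + 1))) <= saturate eps.
  apply: saturate_le; first by rewrite mulr_ge0 // ltW.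
  by rewrite mulrCA ger_pMr // ler_pdivrMr; lra.
have : saturate eps < eps.
  have -> : saturate eps = eps / (1 + eps) by rewrite /saturate; field; lra.
  by rewrite ltr_pdivrMr; nra.
rewrite /eps; lra.
Qed.
End Saturation.

(** * Symmetric rational segments with negation as involution *)

Definition in_segment (n : nat) : pred rat := fun r => - n%:R <= r <= n%:R.

Definition segment n := {x : rat | in_segment n x}.

HB.instance Definition _ n := SubType.on (segment n).
HB.instance Definition _ n := [Choice of segment n by <:].
HB.instance Definition _ n :=
  [SubChoice_isSubOrder of segment n by <: with ring_display].

Lemma segment_oppP n (x : segment n) : in_segment n (- val x).
Proof. by rewrite /in_segment lerN2 lerNl andbC; exact: (valP x). Qed.

Definition segment_opp n (x : segment n) : segment n :=
  exist (in_segment n) _ (segment_oppP x).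

Lemma segment_maxP n : in_segment n n%:R.
Proof. by rewrite /in_segment lexx andbT lerNl (@le_trans _ _ 0) ?oppr_le0. Qed.

Definition segment_max n : segment n := exist (in_segment n) _ (segment_maxP n).

Definition segment_alg n : gAlg :=
  chain_alg (segment_opp (segment_max n)) (segment_max n) (@segment_opp n).

Lemma segment_ge_min n (x : segment n) : segment_opp (segment_max n) <= x.
Proof. by rewrite leEsub /=; case/andP: (valP x). Qed.

Lemma segment_le_max n (x : segment n) : x <= segment_max n.
Proof. by rewrite leEsub /=; case/andP: (valP x). Qed.

Lemma segment_opp_anti n (x y : segment n) :
  x <= y -> segment_opp y <= segment_opp x.
Proof. by rewrite !leEsub /= lerN2. Qed.

Lemma segment_oppK n : involutive (@segment_opp n).
Proof. by move=> x; apply: val_inj; rewrite /= opprK. Qed.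

(** * Coordinates on the chain factors, and suprema of their values *)

Section Representation.
Context (M : mgAlg) (hC : CMGsim M) (si : subdirectly_irreducible M).
Context (N : (M -> Prop) -> nat) (hN : counting N).
Context (d : M) (dd : d = ∼ d) (e01 : (zero : M) <> one).
Implicit Types (x y z c e : M) (q : rat).

Let hM : MGsim M := CMGsim_MGsim hC.
Let hG : Gsim M := MGsim_Gsim hM.
Let kd : closed d := closed_fixpoint hC dd.

Let N0 : N (fun=> False) = 0%N. Proof. by case: hN. Qed.
Let N_mono P Q : (forall y, P y -> Q y) -> (N P <= N Q)%N.
Proof. by case: hN => _ h _; exact: h. Qed.
Let N_empty P : (forall y, ~ P y) -> N P = 0%N.
Proof. by move=> nP; apply/eqP; rewrite -leqn0 -N0; apply: N_mono => y /nP. Qed.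
Let N_ext P Q : (forall y, P y <-> Q y) -> N P = N Q.
Proof. by move=> PQ; apply/eqP; rewrite eqn_leq !N_mono // => y /PQ. Qed.

(** The rank of [c] in the chain of closed elements, counted upwards from [d]. *)
Definition level c : nat := N (fun c' => [/\ closed c', ~ c' ⊑ d & c' ⊑ c]).

Section Projection.
Context (e : M) (pe : prime_central e).

(** The order of the factor onto which [e] projects, as a preorder on [M]. *)
Definition ple x y := x ⊓ e ⊑ y.

Lemma ple_le x y : x ⊑ y -> ple x y.
Proof. by move=> xy; apply: (gle_trans hG) xy; exact: (geIl hG). Qed.

Lemma plexx x : ple x x.
Proof. by apply: ple_le; exact: (glexx hG). Qed.

Lemma ple_trans y x z : ple x y -> ple y z -> ple x z.
Proof.
move=> xy yz; apply: (gle_trans hG) yz; apply: (glexI hG) => //.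
exact: (geIr hG).
Qed.

Lemma ple_total x y : ple x y \/ ple y x.
Proof.
by case: pe => _ _ /(_ x y) [h|h]; [left|right]; apply/(gle_imp hG).
Qed.

Lemma ple_sim x y : ple x y -> ple (∼ y) (∼ x).
Proof.
move=> /(gle_sim hG); rewrite (gsimI hG) => le; case: pe => _ ce _.
rewrite /ple; apply: (gle_trans hG (gleI2 hG le (glexx hG e))).
rewrite (gmeetUl hG) [∼ e ⊓ e](gmeetC hG) (centralI0 hG ce) (gjoin0 hG).
exact: (geIl hG).
Qed.

Lemma ple_simE x y : ple (∼ x) (∼ y) <-> ple y x.
Proof. by split=> /ple_sim //; rewrite !(gsimK hG). Qed.

Lemma ple_d_sim x : ple d (∼ x) <-> ple x d.
Proof. by rewrite {1}dd; exact: ple_simE. Qed.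

(** The closed chain embeds in each factor: [baaz (c ⇒ c')] is closed and central, so [zero] or
    [one], and it lies above the nonzero [e]. *)
Lemma closed_ple c c' : closed c -> closed c' -> ple c c' <-> c ⊑ c'.
Proof.
move=> kc kc'; split; last exact: ple_le.
case: pe => ne ce _ /(gle_impI hG) /(central_le_baaz hG ce).
have [->|e1 _] := si_central_closed hM si (closed_baaz hM (closed_imp hM kc kc'))
  (central_baaz hG _).
  by move/(glex0 hG).
by apply/(gle_imp1 hG)/(gle1x hG); rewrite -e1; exact: (baaz_le hG).
Qed.

Lemma not_ple x y : ~ ple x y -> ple y x.
Proof. by case: (ple_total x y). Qed.

Definition plevel y : nat := N (fun c => [/\ closed c, ~ c ⊑ d & ple c y]).

(** The position of [y] in its gap: it counts the elements below [y] that no closed element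
    separates from [y]. A closed element equivalent to an endpoint separates, so closed elements
    have offset 0. *)
Definition offset y : nat :=
  N (fun z => ple z y /\ ~ exists c, [/\ closed c, ple z c & ple c y]).

Lemma plevel_closed c : closed c -> plevel c = level c.
Proof.
move=> kc; apply: N_ext => c'; split=> -[kc' nd le]; split=> //.
  exact/closed_ple.
exact: ple_le.
Qed.

Lemma offset_closed c : closed c -> offset c = 0%N.
Proof.
by move=> kc; apply: N_empty => z [zc]; apply; exists c; split=> //; exact: plexx.
Qed.

Lemma plevel_mono x y : ple x y -> (plevel x <= plevel y)%N.
Proof.
by move=> xy; apply: N_mono => c [kc nd cx]; split=> //; exact: ple_trans cx xy.
Qed.

Lemma plevel_lt x y c : ple d x -> ple x y -> closed c -> ple c y -> ~ ple c x ->
  (plevel x < plevel y)%N.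
Proof.
move=> dx xy kc cy ncx; apply: (counting_lt (x := c) hN).
- by move=> c' [kc' nd cx]; split=> //; exact: ple_trans cx xy.
- by case.
- by split=> // cd; apply: ncx; exact: ple_trans (ple_le cd) dx.
Qed.

(* For [y] above [d]: the closed elements are sent to the integers, and the gap
   between two consecutive ones into a unit interval, towards whose lower
   (resp. upper) end the elements of the gap move as [q] goes to 0 (resp.
   infinity). *)
Definition upper q y : rat := (plevel y)%:R + saturate ((offset y)%:R * q).

Section Scaling.
Context (q : rat) (q_gt0 : 0 < q).

Let oq_ge0 y : 0 <= (offset y)%:R * q.
Proof. by rewrite mulr_ge0 // ltW. Qed.

Let upper_plevel_lt x y : (plevel x < plevel y)%N -> upper q x < upper q y.
Proof.
rewrite /upper -(ler_nat rat) -addn1 natrD => lt.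
by have := saturate_lt1 (oq_ge0 x); have := saturate_ge0 (oq_ge0 y); lra.
Qed.

Lemma upper_mono x y : ple d x -> ple x y -> upper q x <= upper q y.
Proof.
move=> dx xy.
have [/upper_plevel_lt /ltW //|ge] := ltnP (plevel x) (plevel y).
(* At equal levels every closed element below [y] is below [x], so whatever [offset x] counts is
   counted by [offset y]. *)
have -> : upper q x = (plevel y)%:R + saturate ((offset x)%:R * q).
  by rewrite /upper; congr (_%:R + _); apply/eqP; rewrite eqn_leq ge plevel_mono.
rewrite lerD2l saturate_le // ler_pM2r // ler_nat; apply: N_mono => z [zx nc].
split; first exact: ple_trans xy.
move=> [c [kc zc cy]]; apply: nc; exists c; split=> //.
apply: contrapT => ncx; have := plevel_lt dx xy kc cy ncx.
by rewrite ltnNge ge.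
Qed.

Lemma upper_lt x y : ple d x -> ~ ple y x -> upper q x < upper q y.
Proof.
move=> dx nyx; have xy := not_ple nyx.
have [/upper_plevel_lt //|ge] := ltnP (plevel x) (plevel y).
have no c : closed c -> ple c y -> ple c x.
  move=> kc cy; apply: contrapT => ncx.
  by have := plevel_lt dx xy kc cy ncx; rewrite ltnNge ge.
have -> : upper q x = (plevel y)%:R + saturate ((offset x)%:R * q).
  by rewrite /upper; congr (_%:R + _); apply/eqP; rewrite eqn_leq ge plevel_mono.
rewrite ltrD2l saturate_lt // ltr_pM2r // ltr_nat.
(* [y] itself is counted by its own offset: a closed element equivalent to it would, by [no], be
   below [x]. *)
apply: (counting_lt (x := y) hN).
- move=> z [zx nc]; split; first exact: ple_trans xy.
  by move=> [c [kc zc cy]]; apply: nc; exists c; split=> //; exact: no.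
- by case.
- split; first exact: plexx.
  by move=> [c [kc yc cy]]; apply: nyx; apply: ple_trans yc _; exact: no.
Qed.

Lemma upper_le x y : ple d x -> ple d y -> ple x y <-> upper q x <= upper q y.
Proof.
move=> dx dy; split; first exact: upper_mono.
by move=> le; apply: contrapT => /(upper_lt dy); rewrite ltNge le.
Qed.

Lemma upper_closed c : closed c -> upper q c = (level c)%:R.
Proof.
move=> kc; rewrite /upper plevel_closed // offset_closed // mul0r saturate0.
by rewrite addr0.
Qed.

Lemma upper_d : upper q d = 0.
Proof. by rewrite upper_closed // /level N_empty // => c []. Qed.

Lemma upper_ge0 x : ple d x -> 0 <= upper q x.
Proof. by move=> dx; rewrite -upper_d; exact: upper_mono (plexx d) dx. Qed.

Lemma upper_gt0 x : ~ ple x d -> 0 < upper q x.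
Proof. by move=> nxd; rewrite -upper_d; exact: upper_lt (plexx d) nxd. Qed.

Lemma upper_le_one x : ple d x -> upper q x <= (level one)%:R.
Proof.
move=> dx; rewrite -(upper_closed (closed1 hM)); apply: upper_mono => //.
by apply: ple_le; exact: (glex1 hG).
Qed.

(** Elements not above [d] are reached by reflection, so that [∼] becomes negation. *)
Definition coordinate x : rat :=
  if `[< ple d x >] then upper q x else - upper q (∼ x).

Lemma coordinate_upper x : ple d x -> coordinate x = upper q x.
Proof. by rewrite /coordinate; case: asboolP. Qed.

Lemma coordinate_sim x : coordinate (∼ x) = - coordinate x.
Proof.
rewrite /coordinate; case: asboolP => [/ple_d_sim xd|nxd].
  (* If [x] and [∼ x] are both above [d], they are equivalent to [d] and have coordinate 0. *)
  case: asboolP => [dx|_]; last by rewrite opprK.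
  have x0 : upper q x = 0.
    by apply: le_anti; rewrite upper_ge0 // -upper_d upper_mono.
  have sx : upper q (∼ x) = 0.
    apply: le_anti; rewrite upper_ge0 ?andbT; last exact/ple_d_sim.
    rewrite -upper_d upper_mono //; first exact/ple_d_sim.
    by rewrite dd; exact: ple_sim.
  by rewrite x0 sx oppr0.
rewrite (gsimK hG); case: asboolP => // nd; case: nd; apply: not_ple.
by move=> xd; apply: nxd; apply/ple_d_sim.
Qed.

Lemma coordinate_le x y : ple x y <-> coordinate x <= coordinate y.
Proof.
rewrite /coordinate; case: asboolP => [dx|ndx]; case: asboolP => [dy|ndy].
- exact: upper_le.
- split=> [xy|]; first by case: ndy; exact: ple_trans dx xy.
  have : 0 < upper q (∼ y) by apply: upper_gt0; rewrite dd => /ple_simE.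
  by have := upper_ge0 dx; lra.
- split=> _; last exact: ple_trans (not_ple ndx) dy.
  have : 0 < upper q (∼ x) by apply: upper_gt0; rewrite dd => /ple_simE.
  by have := upper_ge0 dy; lra.
- rewrite lerN2 -ple_simE; apply: upper_le; apply/ple_d_sim; exact: not_ple.
Qed.

Lemma coordinate_bound x : - (level one)%:R <= coordinate x <= (level one)%:R.
Proof.
have L0 : (0 : rat) <= (level one)%:R by [].
rewrite /coordinate; case: asboolP => [dx|ndx].
  by have := upper_ge0 dx; have := upper_le_one dx; lra.
have dx : ple d (∼ x) by apply/ple_d_sim; exact: not_ple.
by have := upper_ge0 dx; have := upper_le_one dx; lra.
Qed.

Definition signed_level c : rat :=
  if `[< d ⊑ c >] then (level c)%:R else - (level (∼ c))%:R.

(** The value depends neither on the factor nor on [q], so closed elements become constant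
    functions. *)
Lemma coordinate_closed c : closed c -> coordinate c = signed_level c.
Proof.
move=> kc; rewrite /coordinate /signed_level.
have -> : `[< ple d c >] = `[< d ⊑ c >]
  by apply: asbool_equiv_eq; exact: closed_ple.
by rewrite !upper_closed //; exact: closed_sim.
Qed.

End Scaling.
End Projection.

(** One point per factor and scale: the factors separate elements, and the scales produce the
    suprema. *)
Definition index := {p : M * rat | prime_central p.1 /\ 0 < p.2}.

Definition point (i : index) (x : M) : segment (level one) :=
  exist (in_segment (level one)) _
    (coordinate_bound (proj1 (proj2_sig i)) (proj2 (proj2_sig i)) x).

Lemma point_hom i : @gsim_hom M (segment_alg (level one)) (point i).
Proof.
case: i => [[e q] /= [pe q0]].
apply: (chain_hom (@segment_ge_min _) (@segment_le_max _) (@segment_opp_anti _)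
  (@segment_oppK _) hG pe).
- by move=> x y; rewrite leEsub /=; exact: coordinate_le.
- by move=> x; apply: val_inj; rewrite /= coordinate_sim.
- apply: val_inj; rewrite /= coordinate_closed //; last exact: (closed1 hM).
  by rewrite /signed_level asboolT //; exact: (glex1 hG).
Qed.

Lemma segment_alg_Gsim n : Gsim (segment_alg n).
Proof.
exact: chain_Gsim (@segment_ge_min n) (@segment_le_max n) (@segment_opp_anti n)
  (@segment_oppK n).
Qed.

Lemma index_inhabited : inhabited index.
Proof.
have [|e pe _] := prime_central_separates hG hN (x := one) (y := zero).
  by move=> /(glex0 hG) /esym.
by constructor; exists (e, 1).
Qed.

Lemma point_inj x y : (forall i, point i x = point i y) -> x = y.
Proof.
move=> eq_xy; suff W x' y' : (forall i, point i x' = point i y') -> x' ⊑ y'.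
  by apply: (gle_anti hG); exact: W.
move=> {x y}eq_xy; apply: contrapT.
move=> /(prime_central_separates hG hN) [e pe]; apply.
pose i : index := exist _ (e, 1) (conj pe ltr01).
apply/(coordinate_le pe ltr01); have := congr1 val (eq_xy i) => /= ->.
exact: lexx.
Qed.

(** Only minimal elements are at hand, so the predecessor is obtained as [∼] of a minimal one. *)
Lemma exists_predecessor c : closed c -> c <> zero -> exists2 p,
  closed p /\ ~ c ⊑ p & forall c', closed c' -> ~ c ⊑ c' -> c' ⊑ p.
Proof.
move=> kc c0.
have [|m _ [[km ncm] mmin]] := @exists_minimal M hG N hN
    (fun z => closed z /\ ~ c ⊑ ∼ z) one.
  split; first exact: (closed1 hM).
  by rewrite (gsim1 hG) => /(glex0 hG).
exists (∼ m); first by split=> //; exact: closed_sim.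
move=> c' kc' ncc'.
have [//|mc'] := si_closed_total hM si kc' (closed_sim hM km).
rewrite -(mmin (∼ c')) ?(gsimK hG); first exact: (glexx hG).
  by split=> //; exact: closed_sim.
by rewrite -[m](gsimK hG); exact: (gle_sim hG).
Qed.

(** In a factor where [x] is not below the predecessor of [∃ x], it is equivalent to [∃ x] or lies
    in the gap just below. In the latter case varying [q] brings its coordinate up to that of
    [∃ x]. *)
Lemma signed_level_le (u : rat) x : - (level one)%:R <= u ->
  (forall e q, prime_central e -> 0 < q -> coordinate e q x <= u) ->
  signed_level (∃ x) <= u.
Proof.
move=> u_ge ub; set c := ∃ x.
have kc : closed c by exact: closed_mexists.
have xc : x ⊑ c by exact: (le_mexists hM).
(* [zero] has no predecessor, but its coordinate is the least value of the segment. *)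
have [c0|c0] := pselect (c = zero).
  have [[[e q] [/= pe q0]]] := index_inhabited.
  rewrite -(coordinate_closed pe q kc) c0 -(gsim1 hG) coordinate_sim //.
  rewrite coordinate_closed //; last exact: (closed1 hM).
  by rewrite /signed_level asboolT //; exact: (glex1 hG).
have [p [kp ncp] pmax] := exists_predecessor kc c0.
have nxp : ~ x ⊑ p by move=> /(mexists_le hM kp).
have [e pe {}nxp] := prime_central_separates hG hN nxp.
have [cx|ncx] := pselect (ple e c x).
  rewrite -(coordinate_closed pe 1 kc); apply: le_trans (ub e 1 pe ltr01).
  exact/coordinate_le.
have below_x c' : closed c' -> c' <> c -> c' ⊑ c -> ple e c' x.
  move=> kc' nc le; apply: (ple_trans (ple_le e (pmax c' kc' _))).
    by move=> cc'; apply: nc; exact: (gle_anti hG).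
  exact: not_ple.
have above_x c' : closed c' -> ple e x c' -> c ⊑ c'.
  move=> kc' xc'; apply: contrapT => /(pmax c' kc') c'p; apply: nxp.
  exact: (ple_trans xc' (ple_le e c'p)).
(* As [d] is closed, the gap of [x] lies entirely on one side of it. *)
have [dx|ndx] := pselect (ple e d x).
  have dc : d ⊑ c by apply/(closed_ple pe kd kc)/(ple_trans dx)/ple_le.
  have ncd : ~ c ⊑ d by move=> cd; apply: ncx; exact: ple_trans (ple_le e cd) dx.
  (* The closed elements above [d] and up to [c] are those below [x] in the factor, and [c]
     itself. *)
  have -> : signed_level c = (plevel e x)%:R + 1.
    rewrite /signed_level asboolT // natr1; congr (_%:R).
    case: hN => _ _ add1; apply: (add1 _ _ c); first by case.
    move=> c'; split=> [[kc' nd le]|[[kc' nd le]|->]].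
    - have [->|nc] := pselect (c' = c); [by right|left].
      by split=> //; exact: below_x.
    - split=> //; apply/(closed_ple pe kc' kc).
      exact: (ple_trans le (ple_le e xc)).
    - by split=> //; exact: (glexx hG).
  (* [x] counts itself, so increasing [q] does move its coordinate. *)
  have ox : 0 < (offset e x)%:R :> rat.
    rewrite ltr0n -[X in (X < _)%N]N0; apply: (counting_lt (x := x) hN) => //.
    split; first exact: plexx.
    move=> [c' [kc' xc' c'x]]; apply: ncx.
    exact: (ple_trans (ple_le e (above_x c' kc' xc')) c'x).
  apply: (saturate_sup ox) => q q0.
  by rewrite -[leLHS](coordinate_upper q dx); exact: ub.
have xd : ple e x d by exact: not_ple.
have cd : c ⊑ d by exact: above_x.
have dsc : d ⊑ ∼ c by rewrite dd; exact: (gle_sim hG).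
have dsx : ple e d (∼ x) by exact/ple_d_sim.
(* Reflection puts [∼ x] in the gap just above [∼ c], so both have the same level. Passing through
   [coordinate_sim] also covers [c = d]. *)
have -> : signed_level c = - (plevel e (∼ x))%:R.
  rewrite -(coordinate_closed pe 1 kc) -[c](gsimK hG) coordinate_sim //.
  rewrite coordinate_closed ?(gsimK hG) //; last exact: closed_sim.
  rewrite /signed_level asboolT //; congr (- _%:R); apply: N_ext => c'.
  split=> -[kc' nd le]; split=> //.
    by apply: ple_le; apply: (gle_trans hG le); exact: (gle_sim hG).
  rewrite -[c'](gsimK hG); apply: (gle_sim hG); apply: above_x.
    exact: closed_sim.
  by apply/(ple_simE pe); rewrite (gsimK hG).
apply: (saturate_inf (t := (offset e (∼ x))%:R)) => // q q0.
rewrite -[X in - X](coordinate_upper q dsx) coordinate_sim // opprK.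
exact: ub.
Qed.

Lemma point_sup x : exists m : segment_alg (level one),
  is_sup (fun i => point i x : segment_alg (level one)) m /\
  forall i, point i (∃ x) = m.
Proof.
have [i0] := index_inhabited; exists (point i0 (∃ x)).
have eq_pt i : point i (∃ x) = point i0 (∃ x).
  case: i i0 => [[e q] [pe q0]] [[e0 r] [pe0 r0]]; apply: val_inj => /=.
  by rewrite !coordinate_closed //; exact: closed_mexists.
split=> //; split=> [i|u ub].
  rewrite -(eq_pt i); apply/chain_gle; rewrite leEsub /=.
  case: i => [[e q] [/= pe q0]]; apply/coordinate_le => //.
  by apply: ple_le; exact: (le_mexists hM).
apply/chain_gle; rewrite leEsub.
case: i0 eq_pt => [[e0 r] [pe0 r0]] eq_pt; rewrite /= coordinate_closed //;
  last exact: closed_mexists.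
apply: signed_level_le; first by case/andP: (valP (u : segment _)).
move=> e q pe q0; pose i : index := exist _ (e, q) (conj pe q0).
by have /chain_gle := ub i; rewrite leEsub.
Qed.

Lemma functional_nontrivial :
  exists N : mgAlg, functional_monadic N /\ isomorphic M N.
Proof.
apply: (functional_of_family hM (segment_alg_Gsim (level one)) point_hom).
- exact: chain_total.
- exact: index_inhabited.
- exact: point_inj.
- exact: point_sup.
Qed.

End Representation.

Local Open Scope classical_set_scope.

Theorem theorem5p5 (M : mgAlg) (hM : CMGsim M)
  (hfin : finite_set [set: M])
  (hsi : subdirectly_irreducible M)
  (hfix : exists d : M, d = sim d) :
  exists N : mgAlg, functional_monadic N /\ isomorphic M N.
Proof.
have [e01|e01] := pselect ((zero : M) = one).
  exact: functional_trivial (CMGsim_MGsim hM) e01.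
have [N hN] := finite_counting hfin; have [d dd] := hfix.
exact: functional_nontrivial hM hsi N hN d dd e01.
Qed.
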